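(* Let $\Omega=\bigcup_{k=1}^nJ_k$, $J_k=(\alpha_k,\beta_k)$, with $-\infty<\alpha_1<\beta_1<\alpha_2<\beta_2<\dots<\alpha_n<\beta_n<\infty$. Assume that $\Omega$ is spectral with spectrum $\Lambda$ that contains $0$ and has period $p$. Suppose there exists an $i\in\{1,\dots,n\}$ such that there exists a unique $j\in\{1,\dots,n\}$ with $\beta_i\equiv_p\alpha_j$. Then: (i) The spectrum $\Lambda$ is contained in $\frac1{\beta_i-\alpha_j}\mathbb{Z}$. (ii) The translate of the interval $J_j$, $J_j'=J_j+\beta_i-\alpha_j=(\beta_i,\beta_j+\beta_i-\alpha_j)$, which has a common endpoint with the interval $J_i$, is disjoint from all $J_k$ with $k\ne i,j$. (iii) The set $\Omega':=J_j'\cup\bigcup_{k\neq j}J_k$ is spectral with the same spectrum $\Lambda$. (iv) The statements analogous to (ii) and (iii) also hold when one replaces the interval $J_i$ by $J_i'=J_i+\alpha_j-\beta_i=(\alpha_i+\alpha_j-\beta_i,\alpha_j)$: that is, $J_i'$, which has a common endpoint with $J_j$, is disjoint from all $J_k$ with $k\neq i,j$, and the set $J_i'\cup\bigcup_{k\ne i}J_k$ is spectral with the same spectrum $\Lambda$.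
   Context: A Borel set $S\subset\mathbb{R}$ of finite positive Lebesgue measure $|S|$ is spectral with spectrum $\Lambda\subset\mathbb{R}$ if $\{|S|^{-1/2}e_\lambda:\lambda\in\Lambda\}$ is an orthonormal basis of $L^2(S)$, where $e_\lambda(x)=e^{2\pi \mathrm{i}\lambda x}$. $\Lambda$ has period $p\in\mathbb{R}\setminus\{0\}$ if $\Lambda+p=\Lambda$. For $t,s\in\mathbb{R}$, $t\equiv_ps$ means $p(t-s)\in\mathbb{Z}$. *)

(* Defs.v *)
From mathcomp Require Import all_boot all_order all_algebra.
From mathcomp Require Import all_classical all_reals all_analysis.
From mathcomp Require Import complex.

Set Implicit Arguments.
Unset Strict Implicit.
Unset Printing Implicit Defensive.

Import Order.TTheory GRing.Theory Num.Theory.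
Import numFieldNormedType.Exports.

Local Open Scope classical_set_scope.
Local Open Scope complex_scope.
Local Open Scope ring_scope.

Section ComplexL2.
Context {R : realType}.
Implicit Types (S L : set R) (f g : R -> R[i]).

Definition cintegral S f : R[i] :=
  Complex (\int[lebesgue_measure]_(x in S) complex.Re (f x))
          (\int[lebesgue_measure]_(x in S) complex.Im (f x)).

(* The square of the L^2(S) norm, in the extended reals. *)
Definition sqnormL2 S f : \bar R :=
  (\int[lebesgue_measure]_(x in S)
     (complex.Re (f x) ^+ 2 + complex.Im (f x) ^+ 2)%:E)%E.

(* L^2(S) is represented by functions, not by classes modulo almost everywhere
   equality; the values outside S are irrelevant. *)
Definition inL2 S f : Prop :=
  [/\ measurable_fun S (fun x => complex.Re (f x)),
      measurable_fun S (fun x => complex.Im (f x))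
    & (sqnormL2 S f < +oo)%E].

Definition innerL2 S f g : R[i] := cintegral S (fun x => f x * (g x)^*).

(* A family b indexed by L is an orthonormal basis of L^2(S): it is orthonormal
   and its finite linear combinations are dense. *)
Definition orthonormal_basisL2 S L (b : R -> R -> R[i]) : Prop :=
  [/\ forall l, L l -> inL2 S (b l),
      forall l m, L l -> L m -> innerL2 S (b l) (b m) = (l == m)%:R
    & forall f, inL2 S f -> forall eps : R, 0 < eps ->
        exists (n : nat) (c : 'I_n -> R[i]) (l : 'I_n -> R),
          (forall k, L (l k)) /\
          (sqnormL2 S (fun x => f x - \sum_(k < n) c k * b (l k) x)%R
             < (eps ^+ 2)%:E)%E].

(* exp (2 pi i l x) *)
Definition expo (l x : R) : R[i] :=
  Complex (cos (2 * pi * l * x)) (sin (2 * pi * l * x)).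

(* Two distinct frequencies give distinct elements of L^2(S), since S has
   positive measure, so the set of normalized exponentials may be treated as a
   family indexed by L. *)
Definition spectral_with S L : Prop :=
  [/\ measurable S,
      (0 < lebesgue_measure S < +oo)%E
    & orthonormal_basisL2 S L (fun l x =>
        ((Num.sqrt (fine (lebesgue_measure S)))^-1)%:C * expo l x)].

Definition translate (A : set R) (t : R) : set R := [set x + t | x in A].

Definition has_period L (p : R) : Prop := p != 0 /\ translate L p = L.

Definition equivp (p t s : R) : Prop := p * (t - s) \is a Num.int.

End ComplexL2.

(* Main.v *)
Require Import Defs.
From mathcomp Require Import all_boot all_order all_algebra.
From mathcomp Require Import all_classical all_reals all_analysis.
From mathcomp Require Import measurable_realfun complex ring lra.

Set Implicit Arguments.
Unset Strict Implicit.
Unset Printing Implicit Defensive.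

Import Order.TTheory GRing.Theory Num.Theory.
Import numFieldNormedType.Exports.
Local Open Scope classical_set_scope.
Local Open Scope ring_scope.

(** Write [e_l] for [expo l] and [d] for [beta i - alpha j].  For [l] in the
    spectrum and every [m], [e_(l + m p)] is orthogonal to [e_0] unless they
    coincide; integrating, the sums of [e_(l + m p)] over the right endpoints
    and over the left endpoints agree.  As [m] varies this is an identity
    between combinations of characters of [Z], so it splits according to the
    classes of endpoints modulo [1/p].  For [l = 0] it says that each class
    has as many right as left endpoints, so the class of [beta i] contains
    only [beta i] and [alpha j]; then [e_l (beta i) = e_l (alpha j)], that is
    [l d] is an integer.  Hence all [e_l] are [d]-periodic.  If [Omega] met
    [Omega + d], the difference of the indicators of a small interval of
    [Omega] and of its translate by [d] inside [Omega] would stay far from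
    all [d]-periodic functions, against density.  So moving any one interval
    by [d] or [-d] is injective on [Omega], and it identifies the two [L^2]
    spaces while fixing every [e_l]. *)

(** * Exponentials as characters of the real line, and their level sets *)

Section Exponentials.
Context {R : realType}.
Implicit Types l m x y d : R.

Lemma expo0 x : expo 0 x = 1.
Proof. by rewrite /expo mulr0 mul0r cos0 sin0. Qed.

Lemma expoDl l m x : expo (l + m) x = expo l x * expo m x.
Proof.
rewrite /expo mulrDr mulrDl cosD sinD.
by apply/eqP; rewrite eq_complex /= eqxx /= addrC [X in _ + X]mulrC mulrC.
Qed.

Lemma expoC l x : expo l x = expo x l.
Proof. by rewrite /expo mulrAC. Qed.

Lemma expoDr l x y : expo l (x + y) = expo l x * expo l y.
Proof. by rewrite expoC expoDl !(expoC l). Qed.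

Lemma expoN l x : expo l (- x) * expo l x = 1.
Proof. by rewrite -expoDr addNr expoC expo0. Qed.

Lemma expo_muln l n x : expo (l *+ n) x = expo l x ^+ n.
Proof.
by elim: n => [|n IHn]; rewrite ?expo0// mulrSr expoDl IHn exprSr.
Qed.

Lemma cos_2pi_eq1 x : cos (2 * pi * x) = 1 -> x \is a Num.int.
Proof.
(* Cosine is even, so [x] may be taken nonnegative; its floor is then a natural number, and
   periodicity can be iterated that many times to reduce [x] to its fractional part [y]. *)
wlog x0 : x / 0 <= x.
  move=> hw; have [/hw//|/ltW x0 c1] := leP 0 x.
  by rewrite -rpredN; apply: hw; rewrite ?oppr_ge0// mulrN cosN.
have /andP[fx xf] := floor_itv x.
have f0 : 0 <= Num.floor x by rewrite floor_ge0.
set y := x - (Num.floor x)%:~R.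
have -> : x = y + (Num.floor x)%:~R by rewrite /y subrK.
have -> : cos (2 * pi * (y + (Num.floor x)%:~R)) = cos (2 * pi * y).
  case: (Num.floor x) f0 => // n _; rewrite mulrDr.
  have -> : 2 * pi * (Posz n)%:~R = pi *+ 2 *+ n :> R.
    by rewrite -pmulrn mulr_natr [2 * pi]mulr_natl.
  exact: (periodicn (@cosD2pi R)).
move=> c1; have y0 : 0 <= y by rewrite subr_ge0.
have y1 : y < 1 by rewrite ltrBlDl -(rmorphD _ _ 1) in xf *.
suff -> : y = 0 by rewrite add0r intr_int.
have p0 := pi_gt0 R.
(* [cos (2 pi y) = 1] forces [cos (pi y) = 1] or [-1]; both [pi y] and [0] lie in [[0, pi]]. *)
have /cos_inj : pi * y \in `[0, pi].
  by rewrite in_itv /= mulr_ge0 ?(ltW p0)//= ler_piMr ?(ltW p0) ?(ltW y1).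
have c2 : cos (pi * y) ^+ 2 = 1.
  move: c1; rewrite -mulrA [2 * _]mulr_natl cos_mulr2n => /eqP.
  by rewrite subr_eq -mulr2n -subr_eq0 -mulrnBl mulrn_eq0 /= subr_eq0 => /eqP.
move=> inj; move/eqP: c2; rewrite sqrf_eq1 => /orP[] /eqP cE.
- have := inj 0; rewrite in_itv /= lexx (ltW p0) cos0 => /(_ isT cE) /eqP.
  by rewrite mulf_eq0 (gt_eqF p0) => /eqP.
- have := inj pi; rewrite in_itv /= lexx (ltW p0) cospi => /(_ isT cE) yE.
  by have := y1; rewrite -(ltr_pM2l p0) mulr1 yE ltxx.
Qed.

Lemma expo_eq1 l x : expo l x = 1 <-> l * x \is a Num.int.
Proof.
split=> [[c1 _]|/intrP[m lxE]]; first by apply: cos_2pi_eq1; rewrite mulrA.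
have nE n : 2 * pi * n%:R = 0 + pi *+ 2 *+ n :> R.
  by rewrite add0r mulr_natr [2 * pi]mulr_natl.
rewrite /expo -mulrA lxE; case: m {lxE} => n.
  by rewrite -pmulrn nE (periodicn (@cosD2pi R)) (periodicn (@sinD2pi R)) cos0 sin0.
rewrite NegzE mulrNz mulrN cosN sinN -pmulrn nE.
by rewrite (periodicn (@cosD2pi R)) (periodicn (@sinD2pi R)) cos0 sin0 oppr0.
Qed.

(** For [l = p] the right-hand side is [equivp p x y]: the classes of endpoints are the fibres of
    [expo p]. *)
Lemma expo_eqP l x y : expo l x = expo l y <-> l * (x - y) \is a Num.int.
Proof.
rewrite -expo_eq1 expoDr; split=> [->|e1]; first by rewrite mulrC expoN.
by rewrite -[LHS]mulr1 -(expoN l y) mulrA e1 mul1r.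
Qed.

End Exponentials.

(* Test the hypothesis against a polynomial whose only node where it does not
   vanish is [u]. *)
Lemma sum_fiber_eq (F : fieldType) (I : finType) (a b z w : I -> F) (u : F) :
  (forall m, \sum_k a k * z k ^+ m = \sum_k b k * w k ^+ m) ->
  \sum_(k | z k == u) a k = \sum_(k | w k == u) b k.
Proof.
move=> ab.
pose s := [seq v <- codom z ++ codom w | v != u].
pose P := \prod_(v <- s) ('X - v%:P).
(* The hypothesis is the case of monomials; linearity in the coefficients extends it to every
   polynomial [Q]. *)
have abP (Q : {poly F}) : \sum_k a k * Q.[z k] = \sum_k b k * Q.[w k].
  rewrite (eq_bigr (fun k => \sum_(m < size Q) Q`_m * (a k * z k ^+ m))); last first.
    by move=> k _; rewrite horner_coef mulr_sumr; apply: eq_bigr => m _; rewrite mulrCA.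
  rewrite exchange_big /=.
  rewrite [RHS](eq_bigr (fun k => \sum_(m < size Q) Q`_m * (b k * w k ^+ m))); last first.
    by move=> k _; rewrite horner_coef mulr_sumr; apply: eq_bigr => m _; rewrite mulrCA.
  rewrite [RHS]exchange_big /=; apply: eq_bigr => m _.
  by rewrite -!mulr_sumr ab.
have Pu : P.[u] != 0.
  by rewrite -[_ == 0]/(root P u) root_prod_XsubC mem_filter eqxx.
have P0 v : v \in codom z ++ codom w -> v != u -> P.[v] = 0.
  by move=> vs vu; apply/eqP; rewrite -[_ == 0]/(root P v) root_prod_XsubC mem_filter vu.
apply: (mulIf Pu); have := abP P.
rewrite (bigID (fun k => z k == u)) /= [X in _ + X]big1 ?addr0; last first.
  by move=> k zk; rewrite P0 ?mulr0// mem_cat codom_f.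
rewrite [RHS](bigID (fun k => w k == u)) /= [X in _ = _ + X]big1 ?addr0; last first.
  by move=> k zk; rewrite P0 ?mulr0// mem_cat codom_f orbT.
rewrite !mulr_suml => e.
rewrite (eq_bigr (fun k => a k * P.[z k])); last by move=> k /eqP ->.
by rewrite e; apply: eq_bigr => k /eqP ->.
Qed.

(** * Integrals over finite unions of intervals, and what orthogonality says about endpoints *)

Section IntervalIntegrals.
Context {R : realType}.
Local Notation mu := (@lebesgue_measure R).

Lemma integral_oo_derive (f F : R -> R) (a b : R) : a < b ->
  continuous f -> (forall x : R, is_derive x 1 F (f x)) ->
  (\int[mu]_(x in `]a, b[) (f x)%:E = (F b - F a)%:E)%E.
Proof.
move=> ab cf dF.
have drv (x : R) : derivable F x 1 by case: (dF x).
have cF (x : R) : {for x, continuous F}.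
  by apply: differentiable_continuous; apply/derivable1_diffP.
rewrite -(integral_itv_bndoo true false); last first.
  apply/measurable_EFinP; apply: measurable_funS (continuous_measurable_fun cf) => //.
rewrite (@continuous_FTC2 _ f F)//.
- exact: continuous_subspaceT.
- split=> [x _||]; first exact: drv.
  + by apply: cvg_at_right_filter; exact: cF.
  + by apply: cvg_at_left_filter; exact: cF.
- by move=> x _; rewrite derive1E; case: (dF x).
Qed.

Lemma Rintegral_bigcup_oo_derive n (alpha beta : 'I_n -> R) (f F : R -> R) :
  (forall k, alpha k < beta k) ->
  (forall k l : 'I_n, (k < l)%N -> beta k < alpha l) ->
  continuous f -> (forall x : R, is_derive x 1 F (f x)) ->
  \int[mu]_(x in \bigcup_k `]alpha k, beta k[%classic) f x =
  \sum_k (F (beta k) - F (alpha k)).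
Proof.
move=> ab ba cf dF.
(* Additivity of the integral applies to a union over a duplicate-free list. *)
have -> : \bigcup_k `]alpha k, beta k[%classic =
    \big[setU/set0]_(k <- enum 'I_n) `]alpha k, beta k[%classic.
  rewrite -bigcup_seq; congr bigcup; apply/seteqP; split=> k //= _.
  by rewrite mem_enum.
rewrite /Rintegral integral_bigsetU_EFin//.
- rewrite (eq_bigr (fun k => (F (beta k) - F (alpha k))%:E)).
    by rewrite sumEFin /= big_enum.
  by move=> k _; rewrite (@integral_oo_derive f F).
- exact: enum_uniq.
- apply/trivIsetP => k l _ _; rewrite neq_ltn => kl.
  apply/seteqP; split=> // x /=; rewrite !in_itv /= => -[/andP[? ?] /andP[? ?]].
  by case/orP: kl => /ba; lra.
- apply/measurable_EFinP.
  by apply: measurable_funS (continuous_measurable_fun cf).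
Qed.

Lemma conjcE (a b : R) : Num.conj (Complex a b) = Complex a (- b).
Proof. by []. Qed.

Lemma mul_real_complex (c a b : R) : (real_complex R c) * Complex a b = Complex (c * a) (c * b).
Proof. by apply/eqP; rewrite eq_complex /= !mul0r subr0 addr0 !eqxx. Qed.

Lemma expo_mul_conj (c l m x : R) :
  (real_complex R c) * expo l x * Num.conj ((real_complex R c) * expo m x)
  = (real_complex R (c ^+ 2)) * expo (l - m) x.
Proof.
have wE : 2 * pi * (l - m) * x = 2 * pi * l * x - 2 * pi * m * x by ring.
rewrite /expo wE !mul_real_complex conjcE cosB sinB.
by apply/eqP; rewrite eq_complex /=; apply/andP; split; apply/eqP; ring.
Qed.

(** For distinct [l] and [m], orthogonality says that the exponential of frequency [l - m] has
    integral zero. A nonzero multiple of that exponential is its own primitive, so its values at the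
    right endpoints and at the left endpoints have equal sums. For [l = m] both sums are [n]. *)
Lemma sum_expo_endpoints n (alpha beta : 'I_n -> R) L l m :
  (forall k, alpha k < beta k) ->
  (forall k l : 'I_n, (k < l)%N -> beta k < alpha l) ->
  spectral_with (\bigcup_k `]alpha k, beta k[%classic) L -> L l -> L m ->
  \sum_k expo (l - m) (beta k) = \sum_k expo (l - m) (alpha k).
Proof.
move=> ab ba [mS /andP[S0 Soo] [_ ortho _]] Ll Lm.
have [->|lm] := eqVneq l m.
  by rewrite subrr; apply: eq_bigr => k _; rewrite !expo0.
move: (ortho l m Ll Lm); rewrite (negbTE lm) /innerL2 /cintegral.
move: S0 Soo; set S := \bigcup_k _ => S0 Soo.
set c : R := (Num.sqrt _)^-1.
have c0 : c ^+ 2 != 0.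
  rewrite sqrf_eq0 invr_eq0 sqrtr_eq0 -ltNge fine_gt0//.
  by rewrite S0 Soo.
pose w := 2 * pi * (l - m).
have w0 : w != 0 by rewrite !mulf_neq0 ?subr_eq0// gt_eqF// pi_gt0.
move=> oE.
(* The real and the imaginary part of the orthogonality relation are integrated separately;
   [false%:R] is its right-hand side [(l == m)%:R] after simplification. *)
have : \int[mu]_(x in S) (c ^+ 2 * cos (w * x)) = 0.
  have <- : complex.Re (false%:R : R[i]%C) = 0 by [].
  rewrite -oE; apply: eq_Rintegral => x _.
  by rewrite expo_mul_conj /expo mul_real_complex.
have : \int[mu]_(x in S) (c ^+ 2 * sin (w * x)) = 0.
  have <- : complex.Im (false%:R : R[i]%C) = 0 by [].
  rewrite -oE; apply: eq_Rintegral => x _.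
  by rewrite expo_mul_conj /expo mul_real_complex.
(* This is the factor common to both primitives; being nonzero, it cancels from the endpoint
   sums. *)
have cw : c ^+ 2 * w^-1 != 0 by rewrite mulf_neq0// invr_eq0.
have cf_sin : continuous (fun x : R => c ^+ 2 * sin (w * x)).
  move=> x; apply: cvgM; first exact: cvg_cst.
  apply: (@continuous_comp _ _ _ (fun x : R => w * x) sin); first exact: mulrl_continuous.
  exact: continuous_sin.
have dF_sin (x : R) :
    is_derive x 1 (fun x : R => c ^+ 2 * w^-1 * - cos (w * x)) (c ^+ 2 * sin (w * x)).
  by apply: is_derive_eq; rewrite /GRing.scale /=; field.
rewrite (Rintegral_bigcup_oo_derive ab ba cf_sin dF_sin).
move=> sinE.
have cf_cos : continuous (fun x : R => c ^+ 2 * cos (w * x)).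
  move=> x; apply: cvgM; first exact: cvg_cst.
  apply: (@continuous_comp _ _ _ (fun x : R => w * x) cos); first exact: mulrl_continuous.
  exact: continuous_cos.
have dF_cos (x : R) :
    is_derive x 1 (fun x : R => c ^+ 2 * w^-1 * sin (w * x)) (c ^+ 2 * cos (w * x)).
  by apply: is_derive_eq; rewrite /GRing.scale /=; field.
rewrite (Rintegral_bigcup_oo_derive ab ba cf_cos dF_cos).
have sumB0 (h : R -> R) : \sum_k (c ^+ 2 * w^-1 * h (beta k) - c ^+ 2 * w^-1 * h (alpha k)) = 0 ->
    \sum_k h (beta k) = \sum_k h (alpha k).
  rewrite sumrB -!mulr_sumr -mulrBr => /eqP.
  by rewrite mulf_eq0 (negbTE cw) /= subr_eq0 => /eqP.
move=> /(sumB0 (fun x => sin (w * x))) sE.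
have /eqP := sumB0 (fun x => - cos (w * x)) sinE.
rewrite !sumrN eqr_opp => /eqP cE.
have sumE (x : 'I_n -> R) : \sum_k expo (l - m) (x k) =
    Complex (\sum_k cos (w * x k)) (\sum_k sin (w * x k)).
  by elim/big_rec3: _ => // k a1 b1 _ _ ->.
by rewrite !sumE sE cE.
Qed.
End IntervalIntegrals.

(** * Translation invariance of Lebesgue measure, and piecewise translations *)

Section Translation.
Context {R : realType}.
Local Notation mu := (@lebesgue_measure R).
Implicit Types (A B : set R) (d : R).

Lemma translateE A d : translate A d = (fun x => x - d) @^-1` A.
Proof.
apply/seteqP; split=> [_ [x Ax <-]|x Ax] /=; first by rewrite addrK.
by exists (x - d) => //; rewrite subrK.
Qed.

Lemma mem_translate A d x : translate A d (x + d) <-> A x.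
Proof. by rewrite translateE /= addrK. Qed.

Lemma preimage_translate A d : (fun x => x + d) @^-1` translate A d = A.
Proof. by rewrite translateE; apply/funext => x; rewrite /preimage /= addrK. Qed.

Lemma translate_oo (a b d : R) :
  translate `]a, b[ d = `]a + d, b + d[%classic.
Proof.
apply/seteqP; rewrite translateE; split=> x /=; rewrite !in_itv /=; lra.
Qed.

Lemma measurable_addr d : measurable_fun [set: R] (fun x => x + d).
Proof. exact: measurable_funD. Qed.

Lemma measurable_translate A d : measurable A -> measurable (translate A d).
Proof.
by move=> mA; rewrite translateE -[X in measurable X]setTI; exact: measurable_addr.
Qed.

Lemma measurable_fun_translate A d (disp : measure_display) (T : measurableType disp)
    (f : R -> T) : measurable A ->
  measurable_fun (translate A d) f -> measurable_fun A (fun x => f (x + d)).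
Proof.
move=> mA mf.
apply: (@measurable_comp _ _ _ _ _ _ (translate A d) f A (fun x => x + d)) => //.
- exact: measurable_translate.
- exact: measurable_funS (measurable_addr d).
Qed.

(** By uniqueness of Lebesgue measure it suffices to compare lengths of half-open intervals. *)
Lemma lebesgue_measure_translate A d : measurable A ->
  pushforward mu ((fun x => x + d) : _ -> measurableTypeR R) A = mu A.
Proof.
move=> mA; apply/esym/lebesgue_measure_unique => //=; first exact: measurable_addr.
move=> _ _ [[a b]] _ <-; rewrite /pushforward.
have -> : (fun x => x + d) @^-1` `]a, b] = `]a - d, b - d]%classic.
  by apply/seteqP; split=> x /=; rewrite !in_itv /=; lra.
rewrite !lebesgue_measure_itv /= !lte_fin ltrD2r; congr (if _ then _ else _).
by rewrite -!EFinB; congr EFin; ring.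
Qed.

(** Change of variables: the integral is taken against the pushforward of [mu] by the shift, which
    agrees with [mu]. *)
Lemma ge0_integral_translate A d (f : R -> \bar R) : measurable A ->
  measurable_fun (translate A d) f -> (forall x, 0 <= f x)%E ->
  (\int[mu]_(x in translate A d) f x = \int[mu]_(x in A) f (x + d)%R)%E.
Proof.
move=> mA mf f0.
have AE : A = ((fun x => x + d) : R -> measurableTypeR R) @^-1` translate A d.
  by rewrite preimage_translate.
rewrite [in RHS]AE -[RHS](@ge0_integral_pushforward _ _ _ (measurableTypeR R) _ _ _ _ _ f) //.
- apply: eq_measure_integral; first exact: measurable_addr.
  by move=> ? B mB _; exact/esym/lebesgue_measure_translate.
- exact: measurable_addr.
- exact: measurable_translate.
Qed.

Lemma integral_translate A d (f : R -> \bar R) : measurable A ->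
  measurable_fun (translate A d) f ->
  (\int[mu]_(x in translate A d) f x = \int[mu]_(x in A) f (x + d)%R)%E.
Proof.
move=> mA mf; rewrite integralE [RHS]integralE !ge0_integral_translate//.
- by apply: (f_equal2 (fun a b => a - b)%E); apply: eq_integral => x _; rewrite ?funeposE ?funenegE.
- exact: measurable_funeneg.
- exact: measurable_funepos.
Qed.

(** For disjoint [A] and [B], this carries [A] to its translate and fixes [B]. It is the piecewise
    translation from the old union of intervals to the new one. *)
Definition slide A d x : R := if x \in A then x + d else x.

Lemma slide_out A B d x : A `&` B = set0 -> x \in B -> slide A d x = x.
Proof.
move=> AB xB; rewrite /slide ifF//; apply/negP => xA.
by have : (A `&` B) x by [split; apply: set_mem]; rewrite AB.
Qed.

Lemma measurable_fun_slide A B d (disp : measure_display) (T : measurableType disp)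
    (f : R -> T) :
  measurable A -> measurable B -> A `&` B = set0 ->
  measurable_fun (translate A d `|` B) f ->
  measurable_fun (A `|` B) (fun x => f (slide A d x)).
Proof.
move=> mA mB AB mf.
have [mf1 mf2] := (measurable_funU f (measurable_translate d mA) mB).1 mf.
apply/measurable_funU => //; split.
- apply: eq_measurable_fun (measurable_fun_translate mA mf1) => x xA.
  by rewrite /slide xA.
- by apply: eq_measurable_fun mf2 => x xB; rewrite (slide_out _ AB).
Qed.

Lemma integral_slide A B d (f : R -> \bar R) :
  measurable A -> measurable B -> A `&` B = set0 -> translate A d `&` B = set0 ->
  measurable_fun (translate A d `|` B) f ->
  (\int[mu]_(x in translate A d `|` B) f x = \int[mu]_(x in A `|` B) f (slide A d x)%R)%E.
Proof.
move=> mA mB AB A'B mf.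
have mA' := measurable_translate d mA.
have [mf1 mf2] := (measurable_funU f mA' mB).1 mf.
rewrite !integral_setU//; last 3 first.
- exact: measurable_fun_slide.
- by rewrite disj_set2E; apply/eqP.
- by rewrite disj_set2E; apply/eqP.
rewrite integral_translate//; congr (_ + _)%E; apply: eq_integral => x xAB.
- by rewrite /slide xAB.
- by rewrite (slide_out _ AB).
Qed.
End Translation.

(** * Transfer of spectra along piecewise translations, and disjointness from periodicity *)

Section Transfer.
Context {R : realType}.
Local Notation mu := (@lebesgue_measure R).
Local Notation C := R[i]%C.
Implicit Types (A B S L : set R) (d : R) (f g : R -> C).

(** These are the first two clauses of [inL2], separated from the finiteness of the norm so that
    they are stable under products. *)
Definition cmeasurable S f : Prop :=
  measurable_fun S (fun x => complex.Re (f x)) /\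
  measurable_fun S (fun x => complex.Im (f x)).

Lemma ReD (z w : C) : complex.Re (z + w) = complex.Re z + complex.Re w.
Proof. by case: z w => [? ?] [? ?]. Qed.

Lemma ImD (z w : C) : complex.Im (z + w) = complex.Im z + complex.Im w.
Proof. by case: z w => [? ?] [? ?]. Qed.

Lemma ReM (z w : C) : complex.Re (z * w) =
  complex.Re z * complex.Re w - complex.Im z * complex.Im w.
Proof. by case: z w => [? ?] [? ?]. Qed.

Lemma ImM (z w : C) : complex.Im (z * w) =
  complex.Re z * complex.Im w + complex.Im z * complex.Re w.
Proof. by case: z w => [? ?] [? ?]. Qed.

Lemma cmeasurable_cst S (z : C) : cmeasurable S (fun=> z).
Proof. by split; exact: measurable_cst. Qed.

Lemma cmeasurableD S f g : cmeasurable S f -> cmeasurable S g ->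
  cmeasurable S (fun x => f x + g x).
Proof.
move=> [rf jf] [rg jg]; split.
- by under eq_fun do rewrite ReD; exact: measurable_funD.
- by under eq_fun do rewrite ImD; exact: measurable_funD.
Qed.

Lemma cmeasurableM S f g : cmeasurable S f -> cmeasurable S g ->
  cmeasurable S (fun x => f x * g x).
Proof.
move=> [rf jf] [rg jg]; split.
- by under eq_fun do rewrite ReM; apply: measurable_funB; exact: measurable_funM.
- by under eq_fun do rewrite ImM; apply: measurable_funD; exact: measurable_funM.
Qed.

Lemma cmeasurable_conj S f : cmeasurable S f ->
  cmeasurable S (fun x => Num.conj (f x)).
Proof.
move=> [rf jf]; split.
- by apply: eq_measurable_fun rf => x _ /=; case: (f x).
- by apply: eq_measurable_fun (measurable_funN jf) => x _ /=; case: (f x).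
Qed.

Lemma cmeasurable_sum S n (F : 'I_n -> R -> C) : (forall k, cmeasurable S (F k)) ->
  cmeasurable S (fun x => \sum_k F k x).
Proof.
elim: n F => [F _|n IHn F mF].
  by under eq_fun do rewrite big_ord0; exact: cmeasurable_cst.
under eq_fun do rewrite big_ord_recr /=.
by apply: cmeasurableD => //; exact: IHn.
Qed.

Lemma cmeasurable_expo S l : cmeasurable S (expo l).
Proof.
have cw : continuous (fun x : R => 2 * pi * l * x) by move=> x; exact: mulrl_continuous.
split; apply: measurable_funS (continuous_measurable_fun _) => // x.
- apply: (@continuous_comp _ _ _ (fun x => 2 * pi * l * x) cos); first exact: cw.
  exact: continuous_cos.
- apply: (@continuous_comp _ _ _ (fun x => 2 * pi * l * x) sin); first exact: cw.
  exact: continuous_sin.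
Qed.

Lemma cmeasurable_scaled_expo S (z : C) l : cmeasurable S (fun x => z * expo l x).
Proof. exact: (cmeasurableM (cmeasurable_cst _ _) (cmeasurable_expo _ _)). Qed.

(** The function is the approximation error in the density clause of [orthonormal_basisL2], with [z]
    the normalizing constant. *)
Lemma cmeasurable_sub_sum S f n (c : 'I_n -> C) (z : C) (l : 'I_n -> R) :
  cmeasurable S f ->
  cmeasurable S (fun x => f x - \sum_(k < n) c k * (z * expo (l k) x)).
Proof.
move=> mf; under eq_fun do rewrite -mulN1r.
apply: cmeasurableD => //; apply: cmeasurableM; first exact: cmeasurable_cst.
apply: cmeasurable_sum => k; apply: cmeasurableM; first exact: cmeasurable_cst.
exact: cmeasurable_scaled_expo.
Qed.

Lemma cmeasurable_sqnorm S f : cmeasurable S f ->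
  measurable_fun S (fun x => (complex.Re (f x) ^+ 2 + complex.Im (f x) ^+ 2)%:E).
Proof.
move=> [rf jf]; apply/measurable_EFinP.
by apply: measurable_funD; exact: measurable_funX.
Qed.

Section Slide.
Variables (A B : set R) (d : R).
Hypotheses (mA : measurable A) (mB : measurable B).
Hypotheses (AB : A `&` B = set0) (AdB : translate A d `&` B = set0).

Lemma cmeasurable_slide f : cmeasurable (translate A d `|` B) f ->
  cmeasurable (A `|` B) (fun x => f (slide A d x)).
Proof.
move=> [rf jf]; split.
- exact: (measurable_fun_slide (f := fun x => complex.Re (f x))).
- exact: (measurable_fun_slide (f := fun x => complex.Im (f x))).
Qed.

Lemma sqnormL2_slide f : cmeasurable (translate A d `|` B) f ->
  sqnormL2 (translate A d `|` B) f = sqnormL2 (A `|` B) (fun x => f (slide A d x)).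
Proof. by move=> mf; rewrite /sqnormL2 integral_slide//; exact: cmeasurable_sqnorm. Qed.

Lemma innerL2_slide f g :
  cmeasurable (translate A d `|` B) f -> cmeasurable (translate A d `|` B) g ->
  innerL2 (translate A d `|` B) f g =
  innerL2 (A `|` B) (fun x => f (slide A d x)) (fun x => g (slide A d x)).
Proof.
move=> mf mg; have [rfg jfg] := cmeasurableM mf (cmeasurable_conj mg).
rewrite /innerL2 /cintegral /Rintegral.
by congr Complex; rewrite integral_slide//; exact/measurable_EFinP.
Qed.

Lemma lebesgue_measure_slide : mu (translate A d `|` B) = mu (A `|` B).
Proof.
have mS : measurable (A `|` B) by exact: measurableU.
have mS' : measurable (translate A d `|` B).
  by apply: measurableU => //; exact: measurable_translate.
have := @integral_slide _ A B d (cst 1%E) mA mB AB AdB (measurable_cst _).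
by rewrite !integral_cst// !mul1e.
Qed.

(** Composition with [slide A d] carries functions on the new set to functions on the old one,
    preserves norms and inner products, and fixes each exponential of [L] by periodicity. The two
    sets have the same measure, so the normalizing constants agree too. *)
Lemma spectral_with_slide L :
  (forall l x, L l -> expo l (x + d) = expo l x) ->
  spectral_with (A `|` B) L -> spectral_with (translate A d `|` B) L.
Proof.
move=> per [mS S0oo [bL2 bortho bdense]].
have slideE l x : L l -> expo l (slide A d x) = expo l x.
  by move=> Ll; rewrite /slide; case: ifP => // _; exact: per.
split; first by apply: measurableU => //; exact: measurable_translate.
  by rewrite lebesgue_measure_slide.
rewrite lebesgue_measure_slide; split.
- move=> l Ll; have [rb jb] := cmeasurable_scaled_expo (translate A d `|` B)
    (real_complex R (Num.sqrt (fine (mu (A `|` B))))^-1) l.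
  split=> //; rewrite sqnormL2_slide//.
  by under [X in sqnormL2 _ X]eq_fun do rewrite slideE//; case: (bL2 l Ll).
- move=> l m Ll Lm; rewrite innerL2_slide; try exact: cmeasurable_scaled_expo.
  under [X in innerL2 _ X]eq_fun do rewrite slideE//.
  by under [X in innerL2 _ _ X]eq_fun do rewrite slideE//; exact: bortho.
- move=> f [rf jf foo] eps eps0.
  have mf : cmeasurable (translate A d `|` B) f by [].
  have [] := bdense (fun x => f (slide A d x)) _ eps eps0.
    have [? ?] := cmeasurable_slide mf.
    by split=> //; rewrite -sqnormL2_slide.
  (* The combination that approximates the pullback of [f] on the old set approximates [f] on the
     new set with the same error. *)
  move=> n [c [l [Ll dist]]]; exists n, c, l; split=> //.
  rewrite sqnormL2_slide.
    by under [X in sqnormL2 _ X]eq_fun do under eq_bigr do rewrite slideE//.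
  exact: cmeasurable_sub_sum.
Qed.

End Slide.


(** An overlap would give an interval [A] of length [2 * e] such that [A] and its translate lie in
    [S] and are disjoint. Against the function equal to [1] on [A] and [-1] on the translate, every
    [d]-periodic function has squared error at least [4 * e], which contradicts density. *)
Lemma spectral_with_disjoint S L d : open S -> d != 0 ->
  (forall l x, L l -> expo l (x + d) = expo l x) ->
  spectral_with S L -> translate S d `&` S = set0.
Proof.
move=> oS d0 per [mS /andP[S0 Soo] [_ _ bdense]].
apply/eqP/negPn/negP => /set0P[_ [[y Sy <-] Sx]].
(* Openness of [S] at [y] and at [y + d] gives the two inclusions. The bound by half of [|d|]
   separates the interval, of length [2 * e], from its translate. *)
have [e e0 [yS xS eled]] : exists2 e : R, 0 < e &
    [/\ `]y - e, y + e[ `<=` S, translate `]y - e, y + e[ d `<=` S & e <= `|d| / 2].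
  have [/= e1 e1_gt0 e1S] := (nbhs_ballP _ _).1 (open_nbhs_nbhs (conj oS Sy)).
  have [/= e2 e2_gt0 e2S] := (nbhs_ballP _ _).1 (open_nbhs_nbhs (conj oS Sx)).
  exists (Num.min (Num.min e1 e2) (`|d| / 2)).
    by rewrite !lt_min e1_gt0 e2_gt0 divr_gt0 ?normr_gt0.
  have le_e1 : Num.min (Num.min e1 e2) (`|d| / 2) <= e1 by rewrite !ge_min lexx.
  have le_e2 : Num.min (Num.min e1 e2) (`|d| / 2) <= e2 by rewrite !ge_min lexx !orbT.
  split; last by rewrite ge_min lexx orbT.
    move=> x /=; rewrite in_itv /= => /andP[? ?]; apply: e1S.
    by rewrite ball_itv /= in_itv /=; clear S0 Soo; lra.
  move=> x; rewrite translate_oo /= in_itv /= => /andP[? ?]; apply: e2S.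
  by rewrite ball_itv /= in_itv /=; clear S0 Soo; lra.
pose A : set R := `]y - e, y + e[%classic.
have mA : measurable A by exact: measurable_itv.
have mA' := measurable_translate d mA.
have AA' : A `&` translate A d = set0.
  apply/seteqP; split=> // x []; rewrite /A translate_oo /= !in_itv /=.
  move=> /andP[? ?] /andP[? ?].
  by move: eled; case: (ger0P d) => d0' ?; clear S0 Soo; lra.
pose f x : C := (\1_A x - \1_(translate A d) x)%:C%C.
have f1 x : A x -> f x = 1.
  move=> Ax; rewrite /f !indicE mem_set// memNset ?subr0// => A'x.
  by have : (A `&` translate A d) x by []; rewrite AA'.
have f2 x : A x -> f (x + d) = -1.
  move=> /(mem_translate A d) A'x; rewrite /f !indicE (mem_set A'x) memNset.
    by rewrite sub0r; apply/eqP; rewrite eq_complex /= oppr0 !eqxx.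
  by move=> Ax; have : (A `&` translate A d) (x + d) by []; rewrite AA'.
have mf : cmeasurable S f.
  by split; [apply: measurable_funB|exact: measurable_cst].
have fL2 : inL2 S f.
  have [rf jf] := mf; split=> //.
  (* The squared modulus of [f] is at most [1], so its integral is at most the measure of [S]. *)
  apply: le_lt_trans Soo; rewrite -[leRHS]mul1e -integral_cst//.
  apply: ge0_le_integral => //.
  - by move=> x _; rewrite lee_fin addr_ge0 ?sqr_ge0.
  - exact: cmeasurable_sqnorm.
  - move=> x _; rewrite lee_fin /f /= expr0n addr0 /indic.
    by case: (x \in A); case: (x \in _) => /=; lra.
(* The value [4 * e] is the integral over [A] of the constant [2], the pointwise lower bound
   obtained at the end. *)
have [] := bdense f fL2 (Num.sqrt (4 * e)); clear S0 Soo; first by rewrite sqrtr_gt0 mulr_gt0.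
move=> n [c [l [Ll]]]; rewrite sqr_sqrtr ?mulr_ge0 ?ltW//.
set z := (X in X%:C%C) => dist.
set g := (fun x => \sum_(k < n) c k * (z%:C%C * expo (l k) x)).
have mN : forall T, measurable T -> T `<=` S -> 
  measurable_fun T (fun x => (complex.Re (f x - g x) ^+ 2 + complex.Im (f x - g x) ^+ 2)%:E).
  move=> T mT TS; apply: measurable_funS TS _ => //.
  by apply: cmeasurable_sqnorm; exact: cmeasurable_sub_sum.
have gper x : g (x + d) = g x.
  by apply: eq_bigr => k _; rewrite per.
move: dist; apply/negP; rewrite -leNgt.
(* Only the error on [A] and its translate is kept. The second part is then shifted back to [A],
   where periodicity makes both errors involve the same value [g x]. *)
apply: (@le_trans _ _ (\int[mu]_(x in A `|` translate A d) 
  (complex.Re (f x - g x) ^+ 2 + complex.Im (f x - g x) ^+ 2)%:E)%E); last first.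
  apply: ge0_subset_integral => //; [exact: measurableU|exact: mN| |].
  - by move=> x _; rewrite lee_fin addr_ge0 ?sqr_ge0.
  - by rewrite subUset.
have AS : A `|` translate A d `<=` S by rewrite subUset.
rewrite ge0_integral_setU//; last 3 first.
- by apply: mN => //; exact: measurableU.
- by move=> x _; rewrite lee_fin addr_ge0 ?sqr_ge0.
- by rewrite disj_set2E; apply/eqP.
rewrite ge0_integral_translate//; last 2 first.
- exact: mN.
- by move=> x; rewrite lee_fin addr_ge0 ?sqr_ge0.
have mNA := mN A mA yS.
have mNA' := measurable_fun_translate mA (mN _ mA' xS).
have N0 (h : R -> C) x : (0 <= (complex.Re (h x) ^+ 2 + complex.Im (h x) ^+ 2)%:E)%E.
  by rewrite lee_fin addr_ge0 ?sqr_ge0.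
rewrite -ge0_integralD//; last first.
- by move=> x _; exact: (N0 (fun x => f (x + d) - g (x + d))).
- by move=> x _; exact: (N0 (fun x => f x - g x)).
apply: (@le_trans _ _ (\int[mu]_(x in A) 2%:E)%E).
  have muA : mu A = (2 * e)%:E.
    rewrite /A lebesgue_measure_itv /= lte_fin ifT; last lra.
    by rewrite -EFinB; congr EFin; ring.
  rewrite integral_cst//; rewrite [X in (_ * X)%E]muA -EFinM lee_fin; lra.
apply: ge0_le_integral => //.
- apply: emeasurable_funD; first exact: mNA.
  exact: mNA'.
(* [|1 - g|^2 + |- 1 - g|^2 = 2 + 2 |g|^2] *)
- move=> x Ax; rewrite gper f1// f2// -EFinD lee_fin.
  case: (g x) => a b /=.
  nra.
Qed.

End Transfer.

(** * Endpoint classes modulo [p], and moving one interval of the union *)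

Section UnionOfIntervals.
Context {R : realType}.
Variables (n : nat) (alpha beta : 'I_n -> R) (L : set R).
Hypothesis ab : forall k : 'I_n, alpha k < beta k.
Hypothesis ba : forall k l : 'I_n, (k < l)%N -> beta k < alpha l.
Local Notation J := (fun k : 'I_n => `]alpha k, beta k[%classic : set R).
Hypothesis spec : spectral_with (\bigcup_k J k) L.

Lemma expo_endpoint_eq (p : R) (i j : 'I_n) : L 0 -> has_period L p ->
  unique (fun k : 'I_n => equivp p (beta i) (alpha k)) j ->
  forall l, L l -> expo l (beta i) = expo l (alpha j).
Proof.
move=> L0 [_ Lp] [hj hjuniq] l Ll.
(* Natural multiples of [p] suffice: they produce the powers [m] in [sum_fiber_eq]. *)
have LpD x m : L x -> L (x + p *+ m).
  elim: m => [|m IHm] Lx; first by rewrite mulr0n addr0.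
  by rewrite mulrSr addrA -Lp; exists (x + p *+ m) => //; exact: IHm.
(* At an endpoint, the exponential of frequency [x + p *+ m] is the weight [expo x] times the [m]-th
   power of the node [expo p], so [sum_fiber_eq] isolates the node of [beta i]. *)
have fibers x : L x ->
    \sum_(k | expo p (beta k) == expo p (beta i)) expo x (beta k) =
    \sum_(k | expo p (alpha k) == expo p (beta i)) expo x (alpha k).
  move=> Lx; apply: (@sum_fiber_eq _ _ _ _ (fun k => expo p (beta k))
    (fun k => expo p (alpha k))) => m.
  have := sum_expo_endpoints ab ba spec (LpD x m Lx) L0.
  by under eq_bigr do rewrite subr0 expoDl expo_muln;
     under [RHS]eq_bigr do rewrite subr0 expoDl expo_muln.
have alphaE : (fun k => expo p (alpha k) == expo p (beta i)) =1 pred1 j.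
  move=> k; apply/eqP/eqP => [/esym/expo_eqP /hjuniq //|->].
  by apply/esym/expo_eqP.
(* At frequency [0] all weights are [1] and the identity counts endpoints. The left fibre is the
   singleton of [j], so the right fibre has one element, which must be [i]. *)
have betaE : (fun k => expo p (beta k) == expo p (beta i)) =1 pred1 i.
  have := fibers 0 L0; rewrite (eq_bigl _ _ alphaE) big_pred1_eq expo0.
  under eq_bigr do rewrite expo0.
  rewrite sumr_const => /eqP; rewrite -[X in _ == X](mulr1n 1) eqr_nat => /eqP.
  move=> /mem_card1[i' i'E] k.
  have /eqP ii : i \in pred1 i'.
    by rewrite -i'E; exact: (eqxx (expo p (beta i))).
  by transitivity (k == i'); [exact: i'E k|rewrite ii].
by have := fibers l Ll; rewrite (eq_bigl _ _ alphaE) (eq_bigl _ _ betaE) !big_pred1_eq.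
Qed.

(** The translate of [J j] lies in the translate of the whole union, which misses the union. A
    general common period [d] serves for moving [J j] towards [J i] and, with the opposite sign,
    [J i] towards [J j]. *)
Lemma spectral_translate_interval (d : R) (j : 'I_n) : d != 0 ->
  (forall l x, L l -> expo l (x + d) = expo l x) ->
  (forall k, translate (J j) d `&` J k = set0) /\
  spectral_with (translate (J j) d `|` \bigcup_(k in [set k | k != j]) J k) L.
Proof.
move=> d0 per.
have oS : open (\bigcup_k J k).
  by apply: bigcup_open => k _; exact: interval_open.
have disj := spectral_with_disjoint oS d0 per spec.
have disjJ k : translate (J j) d `&` J k = set0.
  apply/seteqP; split=> // x [[y Jy <-] Jx].
  by rewrite -disj; split; [exists y => //; exists j|exists k].
split=> //.
have mJ k : measurable (J k) by exact: measurable_itv.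
apply: spectral_with_slide => //.
- by apply: fin_bigcup_measurable => //; exact: finite_finset.
- apply/seteqP; split=> // x [/= Jjx [k /= kj]]; move: Jjx.
  rewrite !in_itv /= => /andP[? ?] /andP[? ?].
  by move: kj; rewrite neq_ltn => /orP[] /ba; lra.
- by rewrite setI_bigcupr bigcup0.
- suff -> : J j `|` \bigcup_(k in [set k | k != j]) J k = \bigcup_k J k by [].
  apply/seteqP; split=> [x [Jx|[k _ Jx]]|x [k _ Jx]]; [by exists j|by exists k|].
  by have [kj|kj] := eqVneq k j; [left; rewrite -kj|right; exists k].
Qed.

End UnionOfIntervals.

Theorem theorem4p13 (R : realType) (n : nat) (alpha beta : 'I_n -> R)
    (L : set R) (p : R) (i j : 'I_n)
    (J := fun k : 'I_n => `]alpha k, beta k[%classic : set R)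
    (J'j := translate (J j) (beta i - alpha j))
    (J'i := translate (J i) (alpha j - beta i))
    (halphabeta : forall k : 'I_n, alpha k < beta k)
    (hbetaalpha : forall k l : 'I_n, (k < l)%N -> beta k < alpha l)
    (hspec : spectral_with (\bigcup_k J k) L)
    (hL0 : L 0)
    (hLp : has_period L p)
    (hij : unique (fun k : 'I_n => equivp p (beta i) (alpha k)) j) :
  L `<=` [set (beta i - alpha j)^-1 * m%:~R | m in [set: int]] /\
  (J'j = `]beta i, beta j + beta i - alpha j[%classic /\
   forall k : 'I_n, k != i -> k != j -> J'j `&` J k = set0) /\
  spectral_with (J'j `|` \bigcup_(k in [set k | k != j]) J k) L /\
  (J'i = `]alpha i + alpha j - beta i, alpha j[%classic /\
   forall k : 'I_n, k != i -> k != j -> J'i `&` J k = set0) /\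
  spectral_with (J'i `|` \bigcup_(k in [set k | k != i]) J k) L.
Proof.
have expoE := expo_endpoint_eq halphabeta hbetaalpha hspec hL0 hLp hij.
(* No right endpoint equals a left one: distinct intervals are separated by gaps, and for [i = j]
   the interval has positive length. *)
have d0 : beta i - alpha j != 0.
  have := halphabeta i; have := halphabeta j.
  have [ij|ji|/val_inj ->] := ltngtP i j; last by lra.
    by have := hbetaalpha _ _ ij; lra.
  by have := hbetaalpha _ _ ji; lra.
have Ld l : L l -> l * (beta i - alpha j) \is a Num.int.
  by move=> /expoE/expo_eqP.
have per l x : L l -> expo l (x + (beta i - alpha j)) = expo l x.
  by move=> /Ld/expo_eq1 e1; rewrite expoDr e1 mulr1.
(* A period may be negated: this is [per] at the point shifted back. *)
have perN l x : L l -> expo l (x + (alpha j - beta i)) = expo l x.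
  by move=> Ll; rewrite -(per l _ Ll); congr expo; ring.
have dN0 : alpha j - beta i != 0 by rewrite -opprB oppr_eq0.
have [disj_j spec_j] := spectral_translate_interval hbetaalpha hspec j d0 per.
have [disj_i spec_i] := spectral_translate_interval hbetaalpha hspec i dN0 perN.
split; [|split; [|split; [|split]]] => //.
- move=> l /Ld/intrP[m lm]; exists m => //.
  by rewrite -lm mulrC mulfK.
- split=> [|k _ _]; last exact: disj_j.
  rewrite /J'j /J translate_oo [_ + (_ - _) in X in `]X, _[]addrC subrK.
  by rewrite addrA.
- split=> [|k _ _]; last exact: disj_i.
  by rewrite /J'i /J translate_oo !addrA [beta i + _]addrC addrK.
Qed.
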